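(* Let $M \in \mathbb{R}^{n \times n}$ be a skew-symmetric matrix in (lower) antitriangular form. Let $P$ be the $n \times n$ permutation matrix given by its columns as $$P = \begin{cases} [e_k, e_{k-1}, e_{k+1}, e_{k-2}, e_{k+2}, \ldots, e_1, e_n], & \text{if } n = 2k-1,\\ [e_k, e_{k+1}, e_{k-1}, e_{k+2}, e_{k-2}, \ldots, e_1, e_n], & \text{if } n = 2k, \end{cases}$$ where $e_1,\dots,e_n$ is the standard basis of $\mathbb{R}^n$. Then $$M = P S P^T,$$ where $S = (s_{ij}) \in \mathbb{R}^{n\times n}$ is a skew-symmetric matrix of the following multi-arrowhead form: (i) if $n$ is odd, then $s_{ij} = 0$ for all $1 \le i < j \le n$ with $j$ even; (ii) if $n$ is even, then $s_{ij} = 0$ for all $1 \le i < j \le n$ with $j$ odd. Moreover, if $n$ is odd, the first row and the first column of $S$ can be made a zero row and a zero column by an additional sequence of rotations in the planes $(1,2), (1,4), \ldots, (1,n-1)$; that is, there exist plane rotations $R_2, R_4, \ldots, R_{n-1}$, with $R_{2j}$ a rotation in the plane $(1,2j)$, such that the matrix $$R_{n-1}^T \cdots R_4^T R_2^T \, S \, R_2 R_4 \cdots R_{n-1}$$ has zero first row and zero first column.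
   Context: A matrix $M = (m_{ij}) \in \mathbb{R}^{n \times n}$ is in (lower) antitriangular form if $m_{ij} = 0$ whenever $i + j \le n$ (all entries strictly above the main antidiagonal vanish; the other entries are arbitrary). Explicitly, the columns of $P$ are as follows. For $n=2k-1$: the first column is $e_k$, and for $t = 1,\dots,k-1$ columns $2t$ and $2t+1$ are $e_{k-t}$ and $e_{k+t}$. For $n=2k$: for $t=0,\dots,k-1$ columns $2t+1$ and $2t+2$ are $e_{k-t}$ and $e_{k+1+t}$. For $p<q$, a rotation in the plane $(p,q)$ is an $n\times n$ matrix equal to the identity except for the entries at the intersections of rows and columns $p,q$, which form the $2\times 2$ matrix $\begin{bmatrix}\cos\varphi & -\sin\varphi\\ \sin\varphi & \cos\varphi\end{bmatrix}$ for some $\varphi\in\mathbb{R}$. For $n=1$ the sequence of rotations is empty. *)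

(* Defs.v *)
From HB Require Import structures.
From mathcomp Require Import all_boot all_order all_algebra all_fingroup.
From mathcomp Require Import zify.
From mathcomp Require Import reals trigo.

Set Implicit Arguments.
Unset Strict Implicit.
Unset Printing Implicit Defensive.

Import Order.TTheory GRing.Theory Num.Theory.
Local Open Scope ring_scope.

(* Ordinals are 0-based: the 1-based index carried by [i : 'I_n] is [i.+1]. *)

Definition skew_symmetric (R : pzRingType) (n : nat) (M : 'M[R]_n) : Prop :=
  M^T = - M.

Definition lower_antitriangular (R : pzRingType) (n : nat) (M : 'M[R]_n) :
  Prop :=
  forall i j : 'I_n, (i.+1 + j.+1 <= n)%N -> M i j = 0.

(* For 1-based [j], column [j] of the permutation matrix is the basis vector
   whose 1-based index is [column_index n j].  Here [uphalf n] is [k] both for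
   [n = 2k - 1] and for [n = 2k]. *)
Definition column_index (n j : nat) : nat :=
  let k := uphalf n in
  if odd n then (if odd j then k + j./2 else k - j./2)%N
  else (if odd j then k - j./2 else k + j./2)%N.

Definition arrowhead_perm_mx (R : pzRingType) (n : nat) : 'M[R]_n :=
  \matrix_(i < n, j < n) (i.+1 == column_index n j.+1)%:R.

Definition rotation_mx (R : realType) (n : nat) (p q : 'I_n) (phi : R) :
  'M[R]_n :=
  \matrix_(i < n, j < n)
    if (i == p) && (j == p) then cos phi
    else if (i == p) && (j == q) then - sin phi
    else if (i == q) && (j == p) then sin phi
    else if (i == q) && (j == q) then cos phi
    else (i == j)%:R.

Definition is_rotation_in_plane (R : realType) (n : nat) (p q : 'I_n)
    (A : 'M[R]_n) : Prop :=
  (p < q)%N /\ exists phi : R, A = rotation_mx p q phi.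

Lemma column_index_bound n j : (0 < j <= n)%N ->
  (0 < column_index n j <= n)%N.
Proof. by rewrite /column_index; case: ifP; case: ifP; lia. Qed.

Lemma column_index_inj n i j : (0 < i <= n)%N -> (0 < j <= n)%N ->
  column_index n i = column_index n j -> i = j.
Proof.
rewrite /column_index; case: ifP => nO; case: ifP => iO; case: ifP => jO; lia.
Qed.

Lemma arrowhead_perm_mx_is_perm (R : pzRingType) n :
  is_perm_mx (arrowhead_perm_mx R n).
Proof.
have ltc (j : 'I_n) : ((column_index n j.+1).-1 < n)%N.
  have := @column_index_bound n j.+1; have := ltn_ord j; lia.
pose f j := Ordinal (ltc j).
have f_inj : injective f.
  move=> i j /(congr1 val) /= eq_ij; apply/val_inj => /=.
  have bi := @column_index_bound n i.+1 (ltn_ord i).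
  have bj := @column_index_bound n j.+1 (ltn_ord j).
  have := @column_index_inj n i.+1 j.+1 (ltn_ord i) (ltn_ord j); lia.
apply/is_perm_mxP; exists (perm f_inj)^-1%g.
apply/matrixP => i j; rewrite !mxE; congr (_%:R); congr nat_of_bool.
rewrite -(inj_eq (@perm_inj _ (perm f_inj))) permKV permE -val_eqE /=.
have := @column_index_bound n j.+1 (ltn_ord j); lia.
Qed.

(* Main.v *)
(* The entry (i, j) of S is the entry (c i, c j) of M, where c = column_index n;
   for i < j the index c i is at least as close to the middle as c j, so that
   c i + c j <= n whenever c j lies in the upper half.

   For n odd (indices being 1-based), the form (i) says that row 1 of S
   only has entries in odd columns.  The rotation in the plane (1, q), q even, can be chosen to kill
   the entry (1, q + 1) by means of the entry (q, q + 1).  It preserves the form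
   (i) and the zeros already created, because S vanishes at (q, j) for every
   j <= q and for every even j > q, and at (j, 1) for 1 < j <= q. *)
Require Import Defs.
From HB Require Import structures.
From mathcomp Require Import all_boot all_order all_algebra all_fingroup.
From mathcomp Require Import zify.
From mathcomp Require Import reals trigo.

Set Implicit Arguments.
Unset Strict Implicit.
Unset Printing Implicit Defensive.

Import Order.TTheory GRing.Theory Num.Theory.
Local Open Scope ring_scope.

(** [perm_mx u] has its ones at (i, u i), so the inverse is what makes column j the basis vector of
    index [s j]. Conjugation by the matrix then becomes the reindexing of entries by [s]. *)
Lemma arrowhead_perm_mxE (R : nzRingType) n :
  exists s : 'S_n, arrowhead_perm_mx R n = perm_mx s^-1
    /\ forall j, (s j).+1 = column_index n j.+1.
Proof.
have /is_perm_mxP[s Ps] := arrowhead_perm_mx_is_perm R n.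
exists s^-1%g; split; first by rewrite invgK.
move=> j; have /matrixP/(_ (s^-1%g j) j) := Ps.
rewrite !mxE permKV eqxx; case: eqP => //= _ /eqP.
by rewrite eq_sym oner_eq0.
Qed.

Lemma skew_symmetricE (R : pzRingType) n (M : 'M[R]_n) i j :
  skew_symmetric M -> M j i = - M i j.
Proof. by move=> /matrixP/(_ i j); rewrite !mxE. Qed.

Lemma skew_symmetric_congr (R : comPzRingType) n (M A : 'M[R]_n) :
  skew_symmetric M -> skew_symmetric (A^T *m M *m A).
Proof.
by move=> Ms; rewrite /skew_symmetric !trmx_mul trmxK Ms mulNmx mulmxN mulmxA.
Qed.

Lemma skew_symmetric_diag (R : numDomainType) n (M : 'M[R]_n) i :
  skew_symmetric M -> M i i = 0.
Proof.
by move=> /(skew_symmetricE i i)/eqP; rewrite eq_sym eqNr => /eqP.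
Qed.

Lemma prod_rev_trmx (R : comPzRingType) n (I : Type) (r : seq I) (P : pred I)
    (F : I -> 'M[R]_n) :
  \prod_(q <- rev r | P q) (F q)^T = (\prod_(q <- r | P q) F q)^T.
Proof.
elim: r => [|x r IHr]; first by rewrite !big_nil trmx1.
rewrite rev_cons -cats1 big_cat /= IHr !big_cons big_nil.
by case: ifP => _; rewrite ?mulr1 // -!mulmxE trmx_mul.
Qed.

Lemma mulmx_rotation (R : realType) n m (p q : 'I_n) phi
    (A : 'M[R]_(m, n)) i j :
  p != q ->
  (A *m rotation_mx p q phi) i j =
    if j == p then A i p * cos phi + A i q * sin phi
    else if j == q then A i q * cos phi - A i p * sin phi
    else A i j.
Proof.
move=> pq; have qp : q != p by rewrite eq_sym.
rewrite mxE (bigD1 p) //= (bigD1 q) //= !mxE !eqxx (negPf pq) (negPf qp) /=.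
have [->|jp] := eqVneq j p.
  rewrite big1 ?addr0 // => k /andP[kp kq].
  by rewrite mxE (negPf kp) (negPf kq) /= mulr0.
have [->|jq] := eqVneq j q.
  rewrite big1 ?addr0 ?mulrN 1?addrC // => k /andP[kp kq].
  by rewrite mxE (negPf kp) (negPf kq) /= mulr0.
rewrite !mulr0 !add0r.
rewrite (bigD1 j) ?jp //= big1 ?addr0 => [|k /andP[/andP[kp kq] kj]].
  by rewrite mxE (negPf jp) (negPf jq) eqxx mulr1.
by rewrite mxE (negPf kp) (negPf kq) (negPf kj) mulr0.
Qed.

(** For b nonzero, take tan phi = - a / b; for b = 0, a right angle makes the cosine vanish. *)
Lemma exists_rotation_angle (R : realType) (a b : R) :
  exists phi, a * cos phi + b * sin phi = 0.
Proof.
have [->|b0] := eqVneq b 0.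
  by exists (pi / 2); rewrite cos_pihalf mulr0 mul0r addr0.
have c0 : cos (atan (- (a / b))) != 0.
  by rewrite cos_atan invr_eq0 gt_eqF // sqrtr_gt0 ltr_wpDr ?sqr_ge0.
exists (atan (- (a / b))); have /eqP := atanK (- (a / b)).
rewrite /tan => /eqP /(canRL (divfK c0)) ->.
by rewrite mulrA mulrN [b * _]mulrC divfK // mulNr subrr.
Qed.

(** Loop invariant of the elimination. Indices are 0-based here, so [odd j] marks the even columns
    of form (i). The bound [m] is inclusive: [m = 0] concerns only a diagonal entry. *)
Definition partly_cleared (R : realType) n (T : 'M[R]_n) (m : nat) : Prop :=
  [/\ skew_symmetric T,
      forall i j : 'I_n, (i < j)%N -> odd j -> T i j = 0
    & forall p j : 'I_n, p = 0%N :> nat -> (j <= m)%N -> T p j = 0].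

Lemma partly_cleared_rotation (R : realType) n (T : 'M[R]_n) (p q r : 'I_n) :
  p = 0%N :> nat -> odd q -> r = q.+1 :> nat -> partly_cleared T q ->
  exists phi, partly_cleared
    ((rotation_mx p q phi)^T *m T *m rotation_mx p q phi) q.+1.
Proof.
move=> p0 oq rq [Ts Tf T0].
have [phi phiP] := exists_rotation_angle (T p r) (T q r); exists phi.
have pq : p != q by apply: contraTneq oq => <-; rewrite p0.
have rp : r != p by rewrite -val_eqE /= rq p0.
have rq' : r != q by rewrite -val_eqE /= rq; lia.
set Q := rotation_mx p q phi; set T' := Q^T *m T *m Q.
have T's : skew_symmetric T' by apply: skew_symmetric_congr.
have T'E i j : T' i j = _ := mulmx_rotation phi (Q^T *m T) i j pq.
have QTE i j : (Q^T *m T) i j =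
    if i == p then T p j * cos phi + T q j * sin phi
    else if i == q then T q j * cos phi - T p j * sin phi
    else T i j.
  (* The action on rows reduces to the one on columns, since Q^T T = (T^T Q)^T. *)
  rewrite -[_ *m _]trmxK trmx_mul trmxK mxE mulmx_rotation //.
  by rewrite !mxE.
have Tpp := skew_symmetric_diag p Ts; have Tqq := skew_symmetric_diag q Ts.
have Tpq : T p q = 0 by apply: Tf; rewrite // p0; lia.
have Tqp : T q p = 0 by rewrite (skew_symmetricE p q Ts) Tpq oppr0.
have Tpo (j : 'I_n) : odd j -> T p j = 0.
  by move=> oj; apply: Tf; rewrite // p0; lia.
have Tqo (j : 'I_n) : odd j -> T q j = 0.
  move=> oj; have [qj|jq|/val_inj <-//] := ltngtP q j; first exact: Tf.
  by rewrite (skew_symmetricE j q Ts) Tf ?oppr0.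
have Tle (j : 'I_n) : (j <= q)%N -> T q j = 0.
  rewrite leq_eqVlt => /predU1P[/val_inj ->//|jq].
  by rewrite (skew_symmetricE j q Ts) Tf ?oppr0.
have Tip (i : 'I_n) : (i <= q)%N -> T i p = 0.
  by move=> iq; rewrite (skew_symmetricE p i Ts) T0 ?oppr0.
split=> //.
- move=> i j ij oj.
  have jp : j != p by apply: contraTneq oj => ->; rewrite p0.
  rewrite T'E (negPf jp); have [jq|jq] := eqVneq j q.
    rewrite !QTE; have iq : (i < q)%N by rewrite -jq.
    have -> : (i == q) = false by apply: ltn_eqF.
    (* In row p, the entry stays zero because the whole block of T on {p, q} vanishes. In any other
       row i < q, both entries mixed by the rotation, (i, q) and (i, p), are already zero. *)
    have [_|ip] := eqVneq i p.
      by rewrite Tpp Tpq Tqp Tqq !(mul0r, addr0, subr0).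
    by rewrite Tf // Tip 1?ltnW // !(mul0r, subr0).
  rewrite QTE; case: eqP => _; first by rewrite Tpo // Tqo // !mul0r addr0.
  case: eqP => _; last exact: Tf.
  by rewrite Tpo // Tqo // !mul0r subr0.
- move=> i j i0 jq; have {i i0}-> : i = p by apply: val_inj; rewrite /= i0.
  rewrite T'E !QTE eqxx Tpp Tpq Tqp Tqq !(mul0r, addr0, subr0).
  case: eqP => // _; case: eqP => // _.
  (* Columns up to q mix zeros only; the new column r = q + 1 is killed by the choice of [phi]. *)
  move: jq; rewrite leq_eqVlt => /predU1P[jr|jq]; last first.
    by rewrite T0 // Tle // !mul0r addr0.
  by have -> : j = r by apply: val_inj; rewrite /= jr.
Qed.

Lemma partly_cleared_prod (R : realType) n (S : 'M[R]_n) (p : 'I_n) m :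
  p = 0%N :> nat -> odd n -> partly_cleared S 0 -> (m <= n)%N ->
  exists phi : nat -> R,
    let Q := \prod_(0 <= i < m | odd i) rotation_mx p (insubd p i) (phi i) in
    partly_cleared (Q^T *m S *m Q) m.
Proof.
move=> p0 on S0; elim: m => [_|m IHm mn].
  by exists (fun=> 0); rewrite big_geq //= trmx1 mul1mx mulmx1.
have [phi /=] := IHm (ltnW mn).
set Q := \prod_(_ <= i < _ | _) _ => QP.
(* For [m] even no rotation is added: column m + 1 is odd, so form (i) already gives the new
   zero. *)
case: (boolP (odd m)) => om; last first.
  exists phi; rewrite /= big_mkcond big_nat_recr //= (negPf om) mulr1.
  rewrite -big_mkcond -/Q; have [Ts Tf T0] := QP; split=> // i j i0.
  rewrite leq_eqVlt => /predU1P[jm|/T0->//].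
  by apply: Tf; rewrite ?jm //= i0.
(* As [n] and [m] are both odd, m < n leaves room for column m + 1. *)
have mn1 : (m.+1 < n)%N by lia.
have [//|a aP] :=
  partly_cleared_rotation (q := Ordinal mn) (r := Ordinal mn1) p0 om _ QP.
exists (fun i => if i == m then a else phi i).
rewrite /= big_mkcond big_nat_recr //= om -big_mkcond eqxx /=.
rewrite (_ : \prod_(_ <= i < _ | _) _ = Q); last first.
  apply: congr_big_nat => // i /andP[_ /andP[_ im]].
  by rewrite (ltn_eqF im).
have -> : insubd p m = Ordinal mn by apply: val_inj; rewrite val_insubd mn.
by rewrite -mulmxE trmx_mul !mulmxA; rewrite !mulmxA in aP.
Qed.

Theorem theorem4p1 (R : realType) (n : nat) (M : 'M[R]_n)
    (M_skew : skew_symmetric M) (M_antitri : lower_antitriangular M) :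
  exists S : 'M[R]_n,
    [/\ M = arrowhead_perm_mx R n *m S *m (arrowhead_perm_mx R n)^T,
        skew_symmetric S,
        odd n -> forall i j : 'I_n,
          (i < j)%N -> ~~ odd j.+1 -> S i j = 0,
        ~~ odd n -> forall i j : 'I_n,
          (i < j)%N -> odd j.+1 -> S i j = 0
      & odd n -> exists Rot : 'I_n -> 'M[R]_n,
          (forall p q : 'I_n, p.+1 = 1%N -> ~~ odd q.+1 ->
             is_rotation_in_plane p q (Rot q)) /\
          (let T := (\prod_(q <- rev (enum 'I_n) | ~~ odd q.+1) (Rot q)^T)
                    *m S *m (\prod_(q < n | ~~ odd q.+1) Rot q) in
           forall p j : 'I_n, p.+1 = 1%N -> T p j = 0 /\ T j p = 0)].
Proof.
have [s [PE sE]] := arrowhead_perm_mxE R n.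
set P := arrowhead_perm_mx R n; set S := P^T *m M *m P; exists S.
have PPT : P *m P^T = 1%:M by rewrite /P PE tr_perm_mx -perm_mxM mulgV perm_mx1.
have SE i j : S i j = M (s i) (s j).
  by rewrite /S /P PE tr_perm_mx invgK -row_permE -col_permE !mxE.
have Ss : skew_symmetric S by apply: skew_symmetric_congr.
have Sodd : odd n -> forall i j : 'I_n,
    (i < j)%N -> ~~ odd j.+1 -> S i j = 0.
  move=> on i j ij oj; rewrite SE; apply: M_antitri; rewrite !sE.
  (* With n = 2k - 1 and j + 1 = 2t, the index of j is k - t and that of i is at most k + t - 1, so
     the sum is at most n. *)
  have := ltn_ord j; move: oj ij; rewrite /column_index on.
  by move=> /negPf -> ij jn; case: ifP => oi; lia.
split=> //.
- by rewrite /S !mulmxA PPT mul1mx -mulmxA PPT mulmx1.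
- move=> en i j ij oj; rewrite SE; apply: M_antitri; rewrite !sE.
  (* With n = 2k and j + 1 = 2t + 1, the indices are k - t and at most k + t. *)
  have := ltn_ord j; rewrite /column_index (negPf en) oj.
  by case: ifP => oi; lia.
move=> on; have n0 : (0 < n)%N by case: (n) on.
pose p := Ordinal n0.
have S0 : partly_cleared S 0.
  split=> // [i j ij oj|i j i0]; first by apply: Sodd; rewrite //= oj.
  rewrite leqn0 => /eqP j0.
  have -> : i = j by apply: val_inj; rewrite /= i0.
  exact: skew_symmetric_diag.
have [phi /= [Ts _ T0]] := partly_cleared_prod (p := p) erefl on S0 (leqnn n).
pose Rot (q : 'I_n) := rotation_mx p (insubd p (q : nat)) (phi q).
exists Rot; split.
  move=> p' q [p'0] oq; have -> : p' = p by apply: val_inj.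
  rewrite /Rot valKd; split; last by exists (phi q).
  by rewrite /=; case: (val q) oq.
have RotE : \prod_(q < n | ~~ odd q.+1) Rot q =
    \prod_(0 <= i < n | odd i) rotation_mx p (insubd p i) (phi i).
  by rewrite big_mkord; apply: eq_bigl => q; rewrite /= negbK.
(* Both products now run over the same sequence, so the left one is the transpose of the right
   one. *)
have enumE : enum 'I_n = index_enum 'I_n by rewrite enumT [RHS]unlock.
rewrite prod_rev_trmx enumE RotE => p' j [p'0].
split; first by apply: T0; rewrite // ltnW.
by rewrite (skew_symmetricE _ _ Ts) T0 ?oppr0 // ltnW.
Qed.
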